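(* For every $k\ge 1$ there is a constant $c_k>0$ such that the following holds. Let $P_1,\dots,P_k$ be oriented paths, each with at least one edge, and write $l_i=l(P_i)$ and $L_i=|P_i|-1$. Then $$l_1\cdots l_k\cdot \max_{i\in[k]}\frac{L_i}{l_i}\;\le\;\mathrm{RT}(P_1,\dots,P_k)\;\le\; c_k\cdot l_1\cdots l_k\cdot\max_{i\in[k]}\frac{L_i}{l_i}.$$
   Context: An oriented path is a path whose edges may be oriented arbitrarily, with no bidirected edges; $|P|$ is its number of vertices. For an oriented path $P$, $l(P)$ is the length (number of edges) of the longest directed subpath of $P$. A tournament is an oriented graph with exactly one edge between every pair of distinct vertices. $\mathrm{RT}(G_1,\dots,G_k)$ is the least $N$ such that in every tournament on $N$ vertices whose edges are coloured with colours $1,\dots,k$ there is an $i$ such that there is a copy (subgraph isomorphic as a directed graph) of $G_i$ all of whose edges have colour $i$. *)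

(* Defs.v *)
From HB Require Import structures.
From mathcomp Require Import all_boot all_order all_algebra.
Set Implicit Arguments. Unset Strict Implicit. Unset Printing Implicit Defensive.

(* An oriented path with n+1 vertices v_0,...,v_n is encoded by s : seq bool of
   size n: the j-th edge joins v_j and v_(j+1), oriented v_j -> v_(j+1) if
   nth false s j = true, and v_(j+1) -> v_j otherwise.  |P| = size s + 1. *)

(* l(P): length (number of edges) of the longest directed subpath.  A subpath
   of a path is a contiguous segment v_i..v_j; it is directed iff all its
   edges have the same orientation. *)
Definition lpath (s : seq bool) : nat :=
  (\max_(i < (size s).+1)
     \max_(j < (size s).+1 | (i <= j) && constant (take (j - i) (drop i s)))
       (j - i))%N.

Definition is_tournament (N : nat) (T : rel 'I_N) : Prop :=
  (forall x, ~~ T x x) /\ (forall x y, x != y -> T x y = ~~ T y x).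

Definition mono_copy (N k : nat) (T : rel 'I_N) (c : 'I_N -> 'I_N -> 'I_k)
  (i : 'I_k) (s : seq bool) : Prop :=
  exists f : 'I_(size s).+1 -> 'I_N, injective f /\
    forall j : 'I_(size s),
      let a := f (widen_ord (leqnSn _) j) in
      let b := f (lift ord0 j) in
      if nth false s j then T a b && (c a b == i) else T b a && (c b a == i).

Definition arrows (k : nat) (P : 'I_k -> seq bool) (N : nat) : Prop :=
  forall (T : rel 'I_N), is_tournament T ->
  forall c : 'I_N -> 'I_N -> 'I_k, exists i : 'I_k, mono_copy T c i (P i).

Definition isRT (k : nat) (P : 'I_k -> seq bool) (N : nat) : Prop :=
  arrows P N /\ (forall M, arrows P M -> (N <= M)%N).

(* Main.v *)
Require Import Defs.
From HB Require Import structures.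
From mathcomp Require Import all_boot all_order all_algebra.
From mathcomp Require Import zify.
From Stdlib Require Import Classical.
Import Order.TTheory GRing.Theory Num.Theory.
Set Implicit Arguments. Unset Strict Implicit. Unset Printing Implicit Defensive.
Local Open Scope nat_scope.

(* Upper bound, by induction on the number of colours: let m be at least every
   L_i / l_i.  In a tournament with more than C m l_1 ... l_k vertices some
   colour i carries enough edges to yield sets A, B in which every vertex of A
   has many out-neighbours in B and every vertex of B many in-neighbours in A.
   A set without edges of colour i is small by induction, so by Gallai-Roy every
   set that is larger by a factor l_i contains a directed path of colour i with
   l_i edges.  Such paths, found inside the unused part of the current
   neighbourhood, absorb the runs of P_i alternately in A and in B. *)

(** * Directed paths and independent sets *)

(* If [g] maximises the number of edges along which it decreases, then [f x], the
   length of the longest path of such edges from [x], is a proper colouring: on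
   an edge [u -> v] with [f u = f v], the map [2 * f + (_ == u)] would beat [g]. *)
Lemma gallai_roy (V : finType) (E : rel V) (l : nat) :
    irreflexive E ->
    (forall x p, path E x p -> uniq (x :: p) -> size p < l) ->
  exists f : V -> nat,
    (forall x, f x < l) /\ (forall x y, E x y -> f x <> f y).
Proof.
move=> irrE El.
pose F (g : {ffun V -> 'I_(2 * l).+1}) := [rel x y : V | E x y && (g y < g x)].
pose wt g := #|[set e : V * V | F g e.1 e.2]|.
case: (@arg_maxnP _ [ffun=> ord0] predT wt isT) => g _ gmax.
have Funiq x p : path (F g) x p -> uniq (x :: p).
  move=> Fp.
  have : sorted gtn [seq nat_of_ord (g y) | y <- x :: p].
    rewrite sorted_map; apply: sub_path Fp => a b /=.
    by case/andP.
  move=> srt; apply: (@map_uniq _ _ (fun y => nat_of_ord (g y))).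
  apply: sorted_uniq srt; last by move=> a /=; rewrite ltnn.
  by move=> a b d /= h1 h2; apply: ltn_trans h2 h1.
have Fsize x p : path (F g) x p -> size p < l.
  move=> Fp; apply: (El x) (Funiq _ _ Fp).
  by apply: sub_path Fp => a b /= /andP[].
pose f x := \max_(j < l | [exists t : j.-tuple V, path (F g) x t]) j.
have fl x : f x < l.
  have l0 : 0 < l by have := El x [::] isT isT; apply: leq_ltn_trans.
  rewrite -(prednK l0) ltnS; apply/bigmax_leqP => j _.
  by rewrite -ltnS prednK.
have fF u v : F g u v -> f v < f u.
  move=> Fuv.
  have l0 : 0 < l by have := fl u; apply: leq_ltn_trans.
  have ex0 : 0 < #|[pred j : 'I_l | [exists t : j.-tuple V, path (F g) v t]]|.
    apply/card_gt0P; exists (Ordinal l0); rewrite inE.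
    by apply/existsP; exists [tuple].
  case: (eq_bigmax_cond (fun j : 'I_l => j : nat) ex0) => j.
  rewrite inE => /existsP[t tP] Efv.
  have Fp : path (F g) u (v :: t) by rewrite /= in tP Fuv *; rewrite Fuv.
  have jl := Fsize _ _ Fp; rewrite /= size_tuple in jl.
  have -> : f v = j by exact: Efv.
  apply: (@leq_bigmax_cond _ _ (fun j : 'I_l => j : nat) (Ordinal jl)).
  by apply/existsP; exists (cons_tuple v t).
exists f; split=> // u v Euv fuv.
have nF : ~~ F g u v by apply/negP => /fF; rewrite fuv ltnn.
pose g' := [ffun w => inord (2 * f w + (w == u)) : 'I_(2 * l).+1].
have g'E w : g' w = 2 * f w + (w == u) :> nat.
  by rewrite ffunE inordK //; have := fl w; case: eqP => _ /=; lia.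
suff: wt g < wt g' by apply/negP; rewrite -leqNgt; exact: gmax.
apply: proper_card; apply/properP; split.
  (* Along an edge of [F g] the value [2 * f] drops by at least 2, which outweighs the indicator;
     along [(u, v)] only the indicator differs. *)
  apply/subsetP=> -[a b]; rewrite !inE /= => Fab.
  have /andP[-> _] : F g a b by [].
  have := fF _ _ Fab; rewrite !g'E.
  by case: (a == u); case: (b == u) => /=; lia.
exists (u, v); rewrite !inE /= ?(negPf nF) //.
rewrite Euv !g'E eqxx fuv; case: eqP => [vu|_]; last by rewrite /=; lia.
by move: Euv; rewrite vu irrE.
Qed.

Definition independent (V : finType) (E : rel V) (W : {set V}) :=
  forall x y, x \in W -> y \in W -> ~~ E x y.

Definition dipath (V : finType) (E : rel V) (Z : {set V}) l x p :=
  [&& all (mem Z) (x :: p), path E x p, uniq (x :: p) & size p == l].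

(** Without such a path, [gallai_roy] applied to [E] restricted to [Z] splits [Z] into [l]
    independent classes, each of size at most [D]. *)
Lemma long_dipath (V : finType) (E : rel V) (Z : {set V}) (l D : nat) :
    irreflexive E ->
    (forall W : {set V}, W \subset Z -> independent E W -> #|W| <= D) ->
    l * D < #|Z| ->
  exists x p, dipath E Z l x p.
Proof.
move=> irrE indD ltZ.
have [/existsP[x /existsP[t Pt]]|noP] :=
  boolP [exists x, [exists t : l.-tuple V, dipath E Z l x t]].
  by exists x, (val t).
have noP' x p : ~~ dipath E Z l x p.
  apply/negP => Pp; case/negP: noP; apply/existsP; exists x.
  have sp : size p == l by case/and4P: Pp.
  by apply/existsP; exists (Tuple sp).
pose EZ := [rel x y | [&& x \in Z, y \in Z & E x y]].
(* For [l = 0] a single vertex of [Z] would do. Positive length matters below, where membership in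
   [Z] is read off the edges of [EZ]. *)
have l0 : 0 < l.
  have /card_gt0P[x xZ] : 0 < #|Z| by apply: leq_ltn_trans ltZ.
  by case: l noP' {ltZ noP} => // /(_ x [::]); rewrite /dipath /= xZ.
have [||f [fl fE]] := @gallai_roy V EZ l.
- by move=> x /=; rewrite irrE !andbF.
- move=> x p EZp Up; rewrite ltnNge; apply/negP => lp.
  have [p0|p0] := posnP (size p); first by rewrite p0 leqNgt l0 in lp.
  apply/negP: (noP' x (take l p)); rewrite negbK /dipath.
  have st : size (take l p) = l by rewrite size_takel.
  have EZt : path EZ x (take l p) by apply: take_path.
  have Ut : uniq (x :: take l p) by exact: (@take_uniq _ (x :: p) l.+1 Up).
  rewrite st Ut eqxx andbT /=; apply/andP; split; last first.
    by rewrite andbT; apply: sub_path EZt => a b /= /and3P[].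
  case: (take l p) EZt st => [_ st|y q /= /andP[/and3P[-> -> _] Ey] _ /=].
    by rewrite -st in l0.
  elim: q y Ey => //= z q IH y /andP[/and3P[_ -> _] /IH ->] //.
have : #|Z| <= l * D; last by rewrite leqNgt ltZ.
have -> : #|Z| = \sum_(j < l) #|[set z in Z | f z == j]|.
  rewrite -sum1_card (partition_big (fun z => Ordinal (fl z)) predT) //=.
  apply: eq_bigr => j _; rewrite -sum1_card; apply: eq_bigl => z.
  by rewrite inE -val_eqE.
rewrite -[l in l * D]card_ord -sum_nat_const; apply: leq_sum => j _.
apply: indD; first by apply/subsetP=> z; rewrite inE => /andP[].
move=> x y; rewrite !inE => /andP[xZ /eqP fx] /andP[yZ /eqP fy].
by apply/negP => Exy; apply: (fE x y); rewrite /= ?xZ ?yZ // fx fy.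
Qed.

(** * Pairs of sets with large minimum degree *)

(* Maximising [e(A,B) + d (|U \ A| + |U \ B|)] makes the deletion of any
   single vertex unprofitable. *)
Lemma dense_pair (V : finType) (E : rel V) (U : {set V}) (d : nat) :
    2 * #|U| * d < \sum_(x in U) #|[set y in U | E x y]| ->
  exists A B : {set V}, [/\ A \subset U, B \subset U, A != set0,
    (forall x, x \in A -> d <= #|[set y in B | E x y]|) &
    (forall y, y \in B -> d <= #|[set x in A | E x y]|)].
Proof.
move=> ltE.
pose e (A B : {set V}) := \sum_(x in A) \sum_(y in B) E x y.
have cardE x (B : {set V}) : #|[set y in B | E x y]| = \sum_(y in B) E x y.
  rewrite -sum1_card big_mkcond [RHS]big_mkcond; apply: eq_bigr => y _.
  by rewrite inE; case: (y \in B); case: (E x y).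
have cardE' y (A : {set V}) : #|[set x in A | E x y]| = \sum_(x in A) E x y.
  rewrite -sum1_card big_mkcond [RHS]big_mkcond; apply: eq_bigr => x _.
  by rewrite inE; case: (x \in A); case: (E x y).
pose phi (AB : {set V} * {set V}) :=
  e AB.1 AB.2 + d * (#|U :\: AB.1| + #|U :\: AB.2|).
pose sub (AB : {set V} * {set V}) := (AB.1 \subset U) && (AB.2 \subset U).
have subU : sub (U, U) by rewrite /sub /= subxx.
case: (arg_maxnP phi subU) => -[A B] /andP[/= AU BU] ABmax.
have eU : \sum_(x in U) #|[set y in U | E x y]| = e U U.
  by apply: eq_bigr => x _; apply: cardE.
have cD1 (W : {set V}) a : W \subset U -> a \in W ->
    #|U :\: (W :\ a)| = (#|U :\: W|).+1.
  move=> WU aW; have := cardsD1 a W; rewrite aW /= => cW.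
  have WaU : W :\ a \subset U by apply: subset_trans (subD1set _ _) WU.
  rewrite !cardsD (setIidPr WU) (setIidPr WaU).
  have := subset_leq_card WU; lia.
exists A, B; split=> //.
(* With [A] empty, [phi] is at most [2 * #|U| * d], less than the number of edges in [U], which is
   [phi (U, U)]. *)
- apply/eqP => A0; suff: phi (A, B) < phi (U, U).
    by apply/negP; rewrite -leqNgt; exact: ABmax.
  rewrite /phi /= setDv cards0 addn0 muln0 addn0 -eU; apply: leq_ltn_trans ltE.
  rewrite A0 /e big_set0 add0n mulnC leq_mul2r; apply/orP; right.
  have := subset_leq_card (subsetDl U set0).
  have := subset_leq_card (subsetDl U B); lia.
- move=> x xA; have := ABmax (A :\ x, B).
  rewrite /sub /phi /= BU (subset_trans (subD1set _ _) AU) => /(_ isT).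
  rewrite cD1 // cardE /e [in X in _ <= X -> _](big_setD1 x) //= => h.
  nia.
- move=> y yB; have := ABmax (A, B :\ y).
  rewrite /sub /phi /= AU (subset_trans (subD1set _ _) BU) => /(_ isT).
  rewrite cD1 // cardE'.
  have -> : e A B = \sum_(x in A) E x y + e A (B :\ y).
    by rewrite /e -big_split; apply: eq_bigr => x _; rewrite (big_setD1 y).
  move=> h; nia.
Qed.

(** * Embedding an oriented path run by run *)

Fixpoint zigzag (V : Type) (E : rel V) (x : V) (s : seq bool) (p : seq V) :=
  match s, p with
  | [::], [::] => true
  | b :: s', y :: p' => (if b then E x y else E y x) && zigzag E y s' p'
  | _, _ => false
  end.

Definition orient (V : Type) (E : rel V) (b : bool) : rel V :=
  fun x y => if b then E x y else E y x.

Lemma zigzag_cat (V : Type) (E : rel V) x b s p q :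
  zigzag E x (nseq (size p) b ++ s) (p ++ q) =
  path (orient E b) x p && zigzag E (last x p) s q.
Proof. by elim: p x => //= y p IHp x; rewrite IHp andbA. Qed.

Lemma zigzagP (V : Type) (E : rel V) x0 x s p : zigzag E x s p ->
  size p = size s /\
  forall j, j < size s ->
    if nth false s j then E (nth x0 (x :: p) j) (nth x0 p j)
    else E (nth x0 p j) (nth x0 (x :: p) j).
Proof.
elim: s x p => [|b s IHs] x [|y p] //= /andP[Exy /IHs[-> nthE]].
by split=> // -[|j] //=; apply: nthE.
Qed.

(** A positional bound on runs passes directly to suffixes, as the induction in [zigzag_embed]
    strips runs from the front. *)
Definition runs_le (l : nat) (s : seq bool) :=
  forall i r b, i + r <= size s ->
    (forall t, t < r -> nth false s (i + t) = b) -> r <= l.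

Lemma runs_le_catl l s1 s2 : runs_le l (s1 ++ s2) -> runs_le l s2.
Proof.
move=> runs i r b ir rb; apply: (runs (size s1 + i) r b).
  by rewrite size_cat -addnA leq_add2l.
by move=> t tr; rewrite nth_cat -addnA ltnNge leq_addr /= addKn rb.
Qed.

Lemma runs_le_nseq l r b s : runs_le l (nseq r b ++ s) -> r <= l.
Proof.
move=> /(_ 0 r b); rewrite size_cat size_nseq leq_addr => /(_ isT); apply.
by move=> t tr; rewrite nth_cat size_nseq tr nth_nseq tr.
Qed.

(** The default [~~ b] of [head] lets an empty remainder count as starting with the opposite
    orientation, so that the recursion needs no separate case. *)
Lemma split_first_run b s :
  exists r s', s = nseq r b ++ s' /\ head (~~ b) s' = ~~ b.
Proof.
elim: s => [|a s [r [s' [-> s'b]]]]; first by exists 0, [::].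
have [->|ab] := eqVneq a b; first by exists r.+1, s'.
by exists 0, (a :: nseq r b ++ s'); split=> //; case: a b ab {s'b} => [] [].
Qed.

(* A run of length [r.+1] follows a directed path inside [A b] for [r] edges
   and then crosses to [A (~~ b)], landing on the start of the next path. *)
Lemma zigzag_embed (V : finType) (E : rel V) (A : bool -> {set V}) (l L D : nat) :
    (forall b x, x \in A b ->
       L + D < #|[set y in A (~~ b) | orient E b x y]|) ->
    (forall b (Z : {set V}), Z \subset A b -> D < #|Z| ->
       exists x p, dipath (orient E b) Z l x p) ->
  forall s b (F : {set V}) x p, runs_le l s -> head b s = b ->
    #|F| + size s <= L -> dipath (orient E b) (A b :\: F) l x p ->
  exists q, [/\ zigzag E x s q, uniq (x :: q) & all (mem (~: F)) (x :: q)].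
Proof.
move=> degA pathA s; have [n] := ubnP (size s).
elim: n s => // n IHn [|a s] ltsn b F x p runs hd FL /and4P[xpF pp Up /eqP sp].
  exists [::]; split=> //=; move: xpF => /= /andP[+ _].
  by rewrite !inE => /andP[-> _].
have {hd}ab : a = b by []; subst a.
have [r [s' [def_s s'b]]] := split_first_run b s.
have {def_s} def_s : b :: s = nseq r.+1 b ++ s' by rewrite def_s.
have runs' : runs_le l s' by apply: (@runs_le_catl _ (nseq r.+1 b)); rewrite -def_s.
have rl : r < l by move: runs; rewrite def_s => /runs_le_nseq.
have szs : (size s).+1 = r.+1 + size s'.
  by have := congr1 size def_s; rewrite size_cat size_nseq.
pose p1 := take r p; pose z := last x p1.
have sp1 : size p1 = r by rewrite size_takel // sp ltnW.
have Up1 : uniq (x :: p1) by exact: (@take_uniq _ (x :: p) r.+1 Up).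
have p1F : all (mem (A b :\: F)) (x :: p1).
  apply/allP => y yp; apply: (allP xpF).
  exact: (mem_take (n0 := r.+1) (s := x :: p) yp).
have pp1 : path (orient E b) x p1 by apply: take_path.
have zA : z \in A b.
  by have := allP p1F z (mem_last _ _); rewrite /= !inE => /andP[].
(* Only the vertices actually used become forbidden, one per edge of the run, which preserves the
   invariant [#|F| + size s <= L]. *)
pose F' := F :|: [set y in x :: p1].
have cF' : #|F'| <= #|F| + r.+1.
  apply: leq_trans (leq_card_setU _ _) _; rewrite leq_add2l cardsE.
  by apply: leq_trans (card_size _) _; rewrite /= sp1.
pose Y := [set y in A (~~ b) | orient E b z y].
have YA : Y :\: F' \subset A (~~ b).
  by apply/subsetP => y; rewrite !inE => /andP[_ /andP[]].
have [|y [p2 yp2]] := pathA _ _ YA.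
  have := degA b z zA; rewrite -/Y cardsD.
  have := subset_leq_card (subsetIr Y F'); rewrite /= in FL; lia.
have /andP[yY yF'] : (y \in Y) && (y \notin F').
  by case/and4P: yp2 => /= /andP[+ _] _ _ _; rewrite inE andbC.
have [|||q [zq Uq qF']] := IHn s' _ (~~ b) F' y p2 runs' s'b.
- by move: ltsn => /=; lia.
- by move: FL => /=; lia.
- case/and4P: yp2 => yp2Y pp2 Up2 sp2; apply/and4P; split=> //.
  apply/allP => w /(allP yp2Y) /=; rewrite !inE => /andP[-> /andP[-> _]] //.
exists (p1 ++ y :: q); split.
- rewrite def_s -[in nseq r.+1 b]sp1 -cat1s.
  rewrite (_ : nseq _ _ ++ s' = nseq (size p1) b ++ b :: s'); last first.
    by elim: (size p1) => //= m ->.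
  rewrite zigzag_cat pp1 /= zq andbT.
  by move: yY; rewrite inE => /andP[_]; rewrite /orient.
- rewrite -cat_cons cat_uniq Up1 Uq andbT [has]lock /= -lock.
  by apply/hasPn => w /(allP qF') /=; rewrite !inE !negb_or => /andP[_].
- rewrite -cat_cons all_cat; apply/andP; split; apply/allP => w.
    by move=> /(allP p1F) /=; rewrite !inE => /andP[].
  by move=> /(allP qF') /=; rewrite !inE negb_or => /andP[].
Qed.

(** * Runs and the longest directed subpath *)

Lemma lpath_ge (s : seq bool) : runs_le (lpath s) s.
Proof.
move=> i r b irs rb.
have i_lt : i < (size s).+1 by lia.
have j_lt : i + r < (size s).+1 by lia.
apply: leq_trans (leq_bigmax (Ordinal i_lt)).
have -> : r = (Ordinal j_lt : nat) - (Ordinal i_lt : nat) by rewrite /= addKn.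
apply: leq_bigmax_cond.
rewrite /= leq_addr /= addKn; apply/(constantP false); exists b.
apply: (@eq_from_nth _ false).
  by rewrite size_nseq.
have sz : size (take r (drop i s)) = r by rewrite size_takel // size_drop; lia.
by rewrite sz => t tr; rewrite nth_take // nth_drop rb // nth_nseq tr.
Qed.

(** With [lpath_ge] this identifies [lpath] as the length of a longest run; the lower bound follows
    a copy along such a run. *)
Lemma lpath_run (s : seq bool) :
  exists i b, i + lpath s <= size s /\
    forall t, t < lpath s -> nth false s (i + t) = b.
Proof.
have ne : 0 < #|'I_(size s).+1| by rewrite card_ord.
have [i Ei] := @bigop.eq_bigmax 'I_(size s).+1 (fun i : 'I_(size s).+1 =>
  \max_(j < (size s).+1 | (i <= j) && constant (take (j - i) (drop i s)))
     (j - i)) ne.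
pose C (j : 'I_(size s).+1) :=
  (i <= j) && constant (take (j - i) (drop i s)).
have neC : 0 < #|C|.
  by apply/card_gt0P; exists i; rewrite unfold_in /C leqnn subnn take0.
have [j /andP[ij cj] Ej] :=
  @bigop.eq_bigmax_cond 'I_(size s).+1 C (fun j => j - i) neC.
have -> : lpath s = j - i by rewrite /lpath Ei Ej.
move/(constantP false): cj => [b cb]; exists i, b; rewrite subnKC //.
split=> [|t tji]; first by rewrite -ltnS.
rewrite -nth_drop -(nth_take false tji) cb nth_nseq.
by rewrite size_takel ?size_drop ?tji // leq_sub2r // -ltnS.
Qed.

Lemma lpath_le_size (s : seq bool) : lpath s <= size s.
Proof. by have [i [b [+ _]]] := lpath_run s; apply: leq_trans; apply: leq_addl. Qed.

Lemma lpath_gt0 (s : seq bool) : 0 < size s -> 0 < lpath s.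
Proof.
move=> s0; apply: (@lpath_ge s 0 1 (nth false s 0)) => // -[] //.
Qed.

(** * Upper bound by induction on the number of colours *)

Lemma zigzag_mono_copy (N k : nat) (T : rel 'I_N) (c : 'I_N -> 'I_N -> 'I_k)
    (i : 'I_k) (s : seq bool) (E : rel 'I_N) x q :
    (forall a b, E a b -> T a b && (c a b == i)) ->
    zigzag E x s q -> uniq (x :: q) ->
  mono_copy T c i s.
Proof.
move=> ET /(zigzagP x)[sz nthE] Uq.
exists (fun j => nth x (x :: q) j); split=> [a b /eqP|j].
  by rewrite nth_uniq //= ?sz // => /eqP /val_inj.
rewrite lift0 /=; move: (nthE j (ltn_ord j)).
by case: ifP => _ /ET.
Qed.

Lemma tournament_edges (N : nat) (T : rel 'I_N) (U : {set 'I_N}) :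
    is_tournament T ->
  #|U| * #|U| = #|U| + 2 * \sum_(x in U) #|[set y in U | T x y]|.
Proof.
move=> [irrT totT].
have cardT x : #|[set y in U | T x y]| = \sum_(y in U) T x y.
  rewrite -sum1_card big_mkcond [RHS]big_mkcond; apply: eq_bigr => y _.
  by rewrite inE; case: (y \in U); case: (T x y).
rewrite (eq_bigr _ (fun x _ => cardT x)).
rewrite mul2n -addnn [X in _ + (_ + X)]exchange_big -big_split /=.
rewrite -sum_nat_const -[X in X + _]sum1_card -big_split.
apply: eq_bigr => x xU /=; rewrite -sum1_card (bigD1 x) //=; congr (1 + _).
rewrite -big_split [RHS](bigD1 x) //= (negPf (irrT x)) !add0n.
apply: eq_bigr => y /andP[_ yx].
by rewrite (totT _ _ yx); case: (T x y).
Qed.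

(** In [avoiding_card] the degree is [d = (ramsey_const n' + 2) * X]: the inductive threshold takes
    [ramsey_const n' * X], the path at most [X], and the last [X] makes the inequality strict. The
    factor [4 * n] and the successor come from [popular_colour]. *)
Fixpoint ramsey_const (n : nat) : nat :=
  if n is n'.+1 then (4 * n * (ramsey_const n' + 2)).+1 else 1.

(** Averaging: if each colour of [S] had at most [2 * #|U| * d] edges, the [#|U| * (#|U| - 1) / 2]
    edges inside [U] would force [#|U| - 1 <= 4 * #|S| * d]. *)
Lemma popular_colour (N k : nat) (T : rel 'I_N) (c : 'I_N -> 'I_N -> 'I_k)
    (S : {set 'I_k}) (U : {set 'I_N}) (d : nat) :
    is_tournament T ->
    (forall x y, x \in U -> y \in U -> T x y -> c x y \in S) ->
    (4 * #|S| * d).+1 < #|U| ->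
  exists2 i, i \in S &
    2 * #|U| * d < \sum_(x in U) #|[set y in U | T x y && (c x y == i)]|.
Proof.
move=> tourT TS ltU.
have [/exists_inP[i iS ilt]|/exists_inPn noi] :=
  boolP [exists i in S,
    2 * #|U| * d < \sum_(x in U) #|[set y in U | T x y && (c x y == i)]|].
  by exists i.
have : \sum_(x in U) #|[set y in U | T x y]| <= #|S| * (2 * #|U| * d).
  rewrite -sum_nat_const.
  apply: (@leq_trans (\sum_(i in S) \sum_(x in U)
     #|[set y in U | T x y && (c x y == i)]|)); last first.
    by apply: leq_sum => i /noi; rewrite -leqNgt.
  rewrite exchange_big; apply: leq_sum => x xU.
  rewrite -sum1_card (partition_big (c x) (mem S)) /=; last first.
    by move=> y; rewrite inE => /andP[yU]; apply: TS.
  apply: leq_sum => i _; rewrite -sum1_card.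
  by apply/eq_leq/eq_bigl => y; rewrite !inE andbA.
have := tournament_edges U tourT; nia.
Qed.

(** Shrinking the set [S] of colours allowed inside [U], instead of [k], keeps [T], [c] and [P]
    fixed: a subset of [U] without edges of colour [i] falls under [S :\ i]. *)
Lemma avoiding_card (N k : nat) (T : rel 'I_N) (c : 'I_N -> 'I_N -> 'I_k)
    (P : 'I_k -> seq bool) (m : nat) :
    is_tournament T -> 0 < m -> (forall i, 0 < size (P i)) ->
    (forall i, size (P i) <= lpath (P i) * m) ->
    (forall i, ~ mono_copy T c i (P i)) ->
  forall (S : {set 'I_k}) (U : {set 'I_N}),
    (forall x y, x \in U -> y \in U -> T x y -> c x y \in S) ->
  #|U| <= ramsey_const #|S| * (m * \prod_(i in S) lpath (P i)).
Proof.
move=> tourT m0 P0 Pm noP S U; move En: #|S| => n.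
elim: n S U En => [|n IHn] S U En TS.
  have S0 : S = set0 by apply/eqP; rewrite -cards_eq0 En.
  rewrite S0 big_set0 muln1 mul1n; apply: leq_trans m0.
  rewrite leqNgt; apply/negP => /card_gt1P[x [y [xU yU xy]]].
  have := TS x y xU yU; have := TS y x yU xU; rewrite S0 !inE.
  by rewrite (tourT.2 _ _ xy); case: (T y x) => [/(_ isT)|_ /(_ isT)].
set X := m * _.
have X0 : 0 < X.
  by rewrite muln_gt0 m0 prodn_cond_gt0 // => i _; apply: lpath_gt0.
rewrite leqNgt; apply/negP => ltU; pose d := (ramsey_const n + 2) * X.
have [|i iS di] := @popular_colour N k T c S U d tourT TS.
  by rewrite En; apply: leq_ltn_trans ltU; rewrite /d /=; nia.
pose E := [rel x y | [&& x \in U, y \in U & T x y && (c x y == i)]].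
have [|A [B [AU BU A0 degA degB]]] := @dense_pair _ E U d.
  apply: leq_trans di _; apply: leq_sum => x xU.
  by apply/subset_leq_card/subsetP => y; rewrite !inE /= xU => /andP[-> ->].
pose l := lpath (P i).
(* [l] times the inductive bound for [S :\ i], the threshold of [long_dipath]; the factor [l]
   restores the missing colour, so [D = ramsey_const n * X]. *)
pose D := l * (ramsey_const n * (m * \prod_(j in S :\ i) lpath (P j))).
pose Ab (b : bool) := if b then A else B.
have Xl : X = m * (l * \prod_(j in S :\ i) lpath (P j)).
  by rewrite /X (big_setD1 i).
have DX : D = ramsey_const n * X by rewrite /D Xl mulnCA [l * (m * _)]mulnCA.
have LX : size (P i) <= X.
  apply: leq_trans (Pm i) _; rewrite Xl mulnA (mulnC m).
  apply: leq_pmulr; rewrite prodn_cond_gt0 // => j _; exact: lpath_gt0.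
have Dd : size (P i) + D < d by rewrite DX /d; nia.
have AbU b : Ab b \subset U by case: b.
have irrE b : irreflexive (orient E b).
  by move=> x; rewrite /orient /= (negPf (tourT.1 x)) !andbF; case: b.
have pathA b (Z : {set 'I_N}) : Z \subset Ab b -> D < #|Z| ->
    exists x p, dipath (orient E b) Z l x p.
  move=> ZA; apply: long_dipath => // W WZ indW.
  have WU : W \subset U.
    by apply: subset_trans WZ (subset_trans ZA (AbU b)).
  apply: IHn => [|x y xW yW Txy].
    by move: (cardsD1 i S); rewrite iS En => -[].
  have [xU yU] := (subsetP WU x xW, subsetP WU y yW).
  rewrite !inE TS // andbT; apply/negP => cxy.
  have := indW x y xW yW; have := indW y x yW xW; rewrite /orient /=.
  by rewrite xU yU Txy cxy; case: b {ZA indW}.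
have degAb b x : x \in Ab b ->
    size (P i) + D < #|[set y in Ab (~~ b) | orient E b x y]|.
  by case: b => [/degA|/degB]; apply: leq_trans.
(* A vertex of [A] makes [B] large, and a vertex of [B] then makes [A] large. *)
have ltAb b : D < #|Ab b|.
  have degC (C : {set 'I_N}) : size (P i) + D < #|C| -> D < #|C|.
    by apply: leq_ltn_trans; apply: leq_addl.
  have le_nbr b' x : x \in Ab b' -> size (P i) + D < #|Ab (~~ b')|.
    move=> /degAb /leq_trans; apply; apply: subset_leq_card.
    by apply/subsetP => y; rewrite inE => /andP[].
  have /set0Pn[x xA] := A0; have ltB : size (P i) + D < #|B| := le_nbr true x xA.
  have /card_gt0P[y yB] : 0 < #|B| by apply: leq_ltn_trans ltB.
  by apply: degC; case: b => //; exact: (le_nbr false y yB).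
have [x [p xp]] := pathA _ _ (subxx (Ab (head true (P i)))) (ltAb _).
have [|||q [zq Uq _]] := zigzag_embed degAb pathA (s := P i)
  (b := head true (P i)) (F := set0) (x := x) (p := p) (@lpath_ge _).
- by case: (P i) => //=.
- by rewrite cards0.
- rewrite setD0; exact: xp.
apply: (noP i); apply: zigzag_mono_copy zq Uq => a b /=.
by case/and4P=> _ _ -> ->.
Qed.

(** * Lower bound from a coloured box *)

Lemma mono_copy_nat (N k : nat) (T : rel 'I_N) (c : 'I_N -> 'I_N -> 'I_k)
    (i : 'I_k) (s : seq bool) :
  mono_copy T c i s ->
  exists g : nat -> 'I_N,
    (forall a b, a <= size s -> b <= size s -> g a = g b -> a = b) /\
    forall j, j < size s ->
      let E a b := T a b && (c a b == i) in
      if nth false s j then E (g j) (g j.+1) else E (g j.+1) (g j).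
Proof.
move=> [f [finj fE]]; exists (fun n => f (inord n)); split=> [a b la lb|j lj].
  by move/finj/(congr1 val); rewrite /= !inordK.
have := fE (Ordinal lj) => /=.
have -> : widen_ord (leqnSn _) (Ordinal lj) = inord j.
  by apply: val_inj; rewrite /= inordK // ltnW.
have -> // : lift ord0 (Ordinal lj) = inord j.+1.
by apply: val_inj; rewrite /= inordK.
Qed.

(** Along a longest run of the copy, [h] would change by at least [lpath s], but it has only
    [lpath s] possible values. *)
Lemma not_mono_copy_monotone (N k : nat) (T : rel 'I_N)
    (c : 'I_N -> 'I_N -> 'I_k) (i : 'I_k) (s : seq bool) (h : 'I_N -> nat) :
    (forall x y, T x y -> c x y = i -> h x < h y) ->
    (forall x, h x < lpath s) ->
  ~ mono_copy T c i s.
Proof.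
move=> hT hl /mono_copy_nat[g [_ gE]].
have [j [b [jl runb]]] := lpath_run s.
have mono t : t <= lpath s ->
    if b then t + h (g j) <= h (g (j + t)) else t + h (g (j + t)) <= h (g j).
  elim: t => [|t IHt] tl; first by rewrite addn0; case: b {runb}.
  have := IHt (ltnW tl); have := gE (j + t); rewrite runb // addnS.
  case: b {runb IHt} => /(_ (leq_trans _ jl)); rewrite ltn_add2l => /(_ tl);
    case/andP=> /hT + /eqP => /[apply]; lia.
have := mono _ (leqnn _); case: b {runb mono} => mono.
  by have := hl (g (j + lpath s)); rewrite ltnNge (leq_trans (leq_addr _ _) mono).
by have := hl (g j); rewrite ltnNge (leq_trans (leq_addr _ _) mono).
Qed.

(** A copy is connected, so all its vertices share the coordinates in [J]; [h0] then separates its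
    [size s + 1] vertices using only [size s] values. *)
Lemma not_mono_copy_bounded (N k : nat) (T : rel 'I_N)
    (c : 'I_N -> 'I_N -> 'I_k) (i : 'I_k) (s : seq bool) (I : Type)
    (J : I -> bool) (h : 'I_N -> I -> nat) (h0 : 'I_N -> 'I_(size s)) :
    (forall x y, T x y -> c x y = i -> forall j, J j -> h x j = h y j) ->
    (forall x y, h0 x = h0 y -> (forall j, J j -> h x j = h y j) -> x = y) ->
  ~ mono_copy T c i s.
Proof.
move=> hT hinj /mono_copy_nat[g [ginj gE]].
have h0j n : n <= size s -> forall j, J j -> h (g n) j = h (g 0) j.
  elim: n => // n IHn ns j Jj; rewrite -(IHn (ltnW ns) j Jj).
  have := gE n ns => /=; case: ifP => _ /andP[Te /eqP ce]; by rewrite (hT _ _ Te ce).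
have : injective (fun n : 'I_(size s).+1 => h0 (g n)).
  have le_s (n : 'I_(size s).+1) : n <= size s by rewrite -ltnS.
  move=> a b hab; apply/val_inj/(ginj _ _ (le_s a) (le_s b)).
  by apply: hinj => // j Jj; rewrite !h0j.
by move/leq_card; rewrite !card_ord ltnn.
Qed.

(* The vertices are the points of a box with side [size (P i0)] in direction
   [i0] and [lpath (P i)] in the others; a pair of points is coloured by some
   direction in which they differ, [i0] only as a last resort, and oriented
   increasingly in that direction. *)
Lemma arrows_lower_bound (k N : nat) (P : 'I_k -> seq bool) (i0 : 'I_k) :
  arrows P N -> size (P i0) * \prod_(i < k | i != i0) lpath (P i) <= N.
Proof.
move=> arr; rewrite leqNgt; apply/negP => ltN.
pose b (i : 'I_k) := if i == i0 then size (P i0) else lpath (P i).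
pose V := {dffun forall i : 'I_k, 'I_(b i)}.
have leV : N <= #|{: V}|.
  apply: ltnW; apply: leq_trans ltN _; rewrite card_dep_ffun foldrE big_map.
  rewrite big_enum /= [X in _ <= X](bigD1 i0) //= card_ord /b eqxx leq_mul2l.
  by apply/orP; right; apply/eq_leq/eq_bigr => i /negPf ne; rewrite card_ord ne.
pose v (x : 'I_N) : V := enum_val (widen_ord leV x).
pose h (x : 'I_N) (i : 'I_k) : nat := v x i.
have hb x i : h x i < b i by exact: ltn_ord.
have hinj x y : (forall i, h x i = h y i) -> x = y.
  move=> hxy; have /enum_val_inj/(congr1 val)/= : v x = v y.
    by apply/ffunP => i; apply/val_inj/hxy.
  exact: val_inj.
(* The pick never returns [i0], so colour [i0] means that all other coordinates agree. *)
pose c x y := odflt i0 [pick i | (i != i0) && (h x i != h y i)].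
have cC x y : c x y = c y x.
  by congr odflt; apply: eq_pick => i; rewrite /= [h x i == _]eq_sym.
have c_i0 x y : c x y = i0 -> forall i, i != i0 -> h x i = h y i.
  rewrite /c; case: pickP => [i /andP[/eqP ni0 _] /ni0 //|same _ i ni0].
  by apply/eqP; have := same i; rewrite ni0 => /negbFE.
have c_ne x y : x != y -> h x (c x y) != h y (c x y).
  move=> ne; have [ci0|ci0] := eqVneq (c x y) i0; last first.
    by move: ci0; rewrite /c; case: pickP => [i /andP[] //|_]; rewrite eqxx.
  rewrite ci0; apply: contra_neqN ne => /eqP eq0; apply: hinj => i.
  by have [->//|ni0] := eqVneq i i0; apply: c_i0 ni0.
pose T x y := h x (c x y) < h y (c x y).
have tourT : is_tournament T.
  split=> [x|x y xy]; first by rewrite /T ltnn.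
  by rewrite /T (cC y x) -leqNgt ltn_neqAle c_ne.
have [i] := arr T tourT c; have [->|ni0] := eqVneq i i0.
  have hs x : h x i0 < size (P i0) by have := hb x i0; rewrite /b eqxx.
  apply: (@not_mono_copy_bounded _ _ _ _ _ _ _ [pred i | i != i0] h
            (fun x => Ordinal (hs x))) => [x y _|x y].
    exact: c_i0.
  move=> /(congr1 val) /= hxy same; apply: hinj => j.
  by have [->|/same] := eqVneq j i0.
apply: (@not_mono_copy_monotone _ _ _ _ _ _ (h^~ i)) => [x y Txy cxy|x].
  by move: Txy; rewrite /T cxy.
by have := hb x i; rewrite /b (negPf ni0).
Qed.

(** * The Ramsey number and its rational bounds *)

Lemma arrows_upper_bound (k m N : nat) (P : 'I_k -> seq bool) :
    0 < m -> (forall i, 0 < size (P i)) ->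
    (forall i, size (P i) <= lpath (P i) * m) ->
    ramsey_const k * (m * \prod_(i < k) lpath (P i)) < N ->
  arrows P N.
Proof.
move=> m0 P0 Pm ltN T tourT c; apply: NNPP => noP.
have := @avoiding_card N k T c P m tourT m0 P0 Pm
  (fun i Pi => noP (ex_intro _ i Pi)) [set: _] [set: _] (fun _ _ _ _ _ => in_setT _).
rewrite !cardsT !card_ord (eq_bigl xpredT) => [|i]; last by rewrite inE.
by rewrite leqNgt ltN.
Qed.

Lemma isRT_exists (k n : nat) (P : 'I_k -> seq bool) :
  arrows P n -> exists2 N, isRT P N & N <= n.
Proof.
elim/ltn_ind: n => n IHn arr.
have [[M ltM arrM]|noM] := classic (exists2 M, M < n & arrows P M).
  by have [N RN NM] := IHn M ltM arrM; exists N => //; apply: leq_trans (ltnW ltM).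
exists n => //; split=> // M arrM; rewrite leqNgt; apply/negP => ltM.
by apply: noM; exists M.
Qed.

Local Open Scope ring_scope.

Theorem mainTheorem3 :
  forall k : nat, (0 < k)%N ->
  exists c : rat, 0 < c /\
  forall P : 'I_k -> seq bool, (forall i, (0 < size (P i))%N) ->
  exists N : nat, isRT P N /\
    let M : rat := (\prod_(i < k) ((lpath (P i))%:R : rat)) *
                   \big[Num.max/0]_(i < k)
                      ((size (P i))%:R / (lpath (P i))%:R) in
    M <= N%:R /\ N%:R <= c * M.
Proof.
(* The 2 pays for rounding the ratios up to the integer [m], the successor for the extra vertex in
   [X.+1]. *)
move=> k k0; pose c : nat := (2 * (ramsey_const k).+1)%N.
exists c%:R; split; first by rewrite ltr0n.
move=> P P0; have l0 i := lpath_gt0 (P0 i).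
have lR0 i : 0 < (lpath (P i))%:R :> rat by rewrite ltr0n.
pose m := (\max_(i < k) (size (P i) %/ lpath (P i)).+1)%N.
have ne : (0 < #|'I_k|)%N by rewrite card_ord.
have [i1 Em] := @bigop.eq_bigmax 'I_k (fun i => (size (P i) %/ lpath (P i)).+1) ne.
have m0 : (0 < m)%N by rewrite /m Em.
have Pm i : (size (P i) <= lpath (P i) * m)%N.
  apply: (@leq_trans (lpath (P i) * (size (P i) %/ lpath (P i)).+1)).
    by rewrite mulnC; apply/ltnW/ltn_ceil.
  by rewrite leq_mul2l (bigop.leq_bigmax i) orbT.
set R := \big[Num.max/0]_(i < k) ((size (P i))%:R / (lpath (P i))%:R : rat).
have R_ge i : (size (P i))%:R / (lpath (P i))%:R <= R.
  exact: (@le_bigmax _ _ _ _ (fun i => (size (P i))%:R / (lpath (P i))%:R : rat)).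
(* As [lpath (P i1) <= size (P i1)], the ratio is at least 1, so its floor plus 1 is at most twice
   it. *)
have mR : m%:R <= 2 * R.
  rewrite /m Em; apply: (@le_trans _ _ (2 * ((size (P i1))%:R / (lpath (P i1))%:R))).
    rewrite mulrA ler_pdivlMr // -!natrM ler_nat.
    have := leq_trunc_div (size (P i1)) (lpath (P i1)).
    by have := lpath_le_size (P i1); rewrite mulSn; lia.
  by rewrite ler_pM2l.
set X := (ramsey_const k * (m * \prod_(i < k) lpath (P i)))%N.
have [N RN leN] := isRT_exists (@arrows_upper_bound k m X.+1 P m0 P0 Pm (leqnn _)).
exists N; split=> //=; rewrite -natr_prod -/R; split.
  (* At an index [i0] attaining the maximum, [lpath (P i0)] cancels and leaves the volume of the box
     in [arrows_lower_bound]. *)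
  have [i0 _ ER] : {i0 : 'I_k | true & R = (size (P i0))%:R / (lpath (P i0))%:R}.
    apply: (@eq_bigmax _ _ _ 0 i1) => // i _.
    by rewrite divr_ge0 ?ler0n.
  rewrite ER (bigD1 i0) //= natrM mulrC -mulrA mulKf ?gt_eqF //.
  by rewrite -natrM ler_nat; apply: arrows_lower_bound; case: RN.
have Q0 : (0 < m * \prod_(i < k) lpath (P i))%N.
  by rewrite muln_gt0 m0 prodn_gt0.
apply: (@le_trans _ _ ((ramsey_const k).+1 * (m * \prod_(i < k) lpath (P i)))%N%:R).
  by rewrite ler_nat (leq_trans leN) // mulSn -add1n leq_add2r.
rewrite natrM natrM /c natrM [2%:R * _]mulrC -mulrA ler_pM2l ?ltr0n //.
by rewrite mulrC mulrCA ler_wpM2l ?ler0n.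
Qed.
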